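(* Let $A,B\subseteq P\omega$ be subspaces, let $\alpha,\beta<\omega_1$, and let $f:A\to B$ be a $\mathbf{\Sigma}^0_{1+\alpha}$-measurable bijection whose inverse $g=f^{-1}$ is $\mathbf{\Sigma}^0_{1+\beta}$-measurable. Put $\mu=\max\{\alpha,\beta\}$. Then there exist $A^\ast\in\mathbf{\Pi}^0_{1+\alpha+\mu+1}(P\omega)$, $B^\ast\in\mathbf{\Pi}^0_{1+\beta+\mu+1}(P\omega)$ and a $\mathbf{\Sigma}^0_{1+\alpha}$-measurable bijection $f^\ast:A^\ast\to B^\ast$ whose inverse $g^\ast=f^{\ast-1}$ is $\mathbf{\Sigma}^0_{1+\beta}$-measurable, such that $A\subseteq A^\ast$, $B\subseteq B^\ast$, $f^\ast|_A=f$ and $g^\ast|_B=g$.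
   Context: Sums of ordinals are ordinal additions. $P\omega$ is the power set of $\omega$ with the Scott topology (basic open sets $\{A\subseteq\omega\mid F\subseteq A\}$, $F$ finite). A function $f:X\to Z$ is $\Gamma$-measurable if $f^{-1}(U)\in\Gamma(X)$ for every open $U\subseteq Z$. For an arbitrary topological space $X$: $\mathbf{\Sigma}^0_0(X)=\{\emptyset\}$; $\mathbf{\Sigma}^0_1(X)$ = open sets; $\mathbf{\Sigma}^0_2(X)$ = countable unions of sets $U\setminus V$ with $U,V$ open; for $2<\gamma<\omega_1$, $\mathbf{\Sigma}^0_\gamma(X)$ = countable unions of sets whose complements lie in $\bigcup_{\delta<\gamma}\mathbf{\Sigma}^0_\delta(X)$; $\mathbf{\Pi}^0_\gamma(X)$ = complements of $\mathbf{\Sigma}^0_\gamma(X)$-sets. *)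

(* Defs.v *)
From HB Require Import structures.
From mathcomp Require Import all_boot all_order.
From mathcomp Require Import all_classical.
From mathcomp Require Import topology.

Set Implicit Arguments.
Unset Strict Implicit.
Unset Printing Implicit Defensive.

Local Open Scope classical_set_scope.

(* Countable ordinals as well-founded trees: [osup s] denotes the ordinal
   sup_n (s n + 1). A given ordinal has many codes: equality of ordinals is
   [oeq], not Leibniz equality. Every ordinal below omega_1 has a code, see
   [cord_rank] below. *)
Inductive cord : Type :=
| ozero : cord
| osup : (nat -> cord) -> cord.

Definition osucc (a : cord) : cord := osup (fun=> a).

Definition oone : cord := osucc ozero.
Definition otwo : cord := osucc oone.

Fixpoint ole (a b : cord) : Prop :=
  match a with
  | ozero => True
  | osup s => forall n,
      match b with
      | ozero => False
      | osup t => exists m, ole (s n) (t m)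
      end
  end.

Definition olt (a b : cord) : Prop := ole (osucc a) b.

Definition oeq (a b : cord) : Prop := ole a b /\ ole b a.

(* a + sup_n (t n + 1) = sup_n ((a + t n) + 1) *)
Fixpoint oadd (a b : cord) : cord :=
  match b with
  | ozero => a
  | osup t => osup (fun n => oadd a (t n))
  end.

Definition omax (a b : cord) : cord := if `[< ole a b >] then b else a.

Lemma ole_refl a : ole a a.
Proof. by elim: a => //= s IH n; exists n. Qed.

Lemma ole_trans b a c : ole a b -> ole b c -> ole a c.
Proof.
elim: a b c => [//|s IH] [|t] [|u] /= Hab Hbc n.
- by have := Hab n.
- by have := Hab n.
- by have [m _] := Hab n; have := Hbc m.
- have [m Hm] := Hab n; have [k Hk] := Hbc m.
  by exists k; apply: IH Hm Hk.
Qed.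

Lemma olt_osup a t : olt a (osup t) <-> exists m, ole a (t m).
Proof. by split=> [/(_ 0%N)//|H n]. Qed.

Lemma ole_osup s b : ole (osup s) b <-> forall n, olt (s n) b.
Proof. by split=> [H n k|H n]; [exact: H|exact: (H n 0%N)]. Qed.

Lemma olt_ole_trans b a c : olt a b -> ole b c -> olt a c.
Proof. exact: ole_trans. Qed.

Lemma ole_olt_trans b a c : ole a b -> olt b c -> olt a c.
Proof.
case: c => [_ /(_ 0%N)//|u] ab /olt_osup[m bu].
by apply/olt_osup; exists m; apply: ole_trans ab bu.
Qed.

Lemma oltW a b : olt a b -> ole a b.
Proof.
elim: a b => [//|s IH] [|t] Hab; first by have := Hab 0%N.
have /olt_osup[m Hm] := Hab.
apply/ole_osup => n; apply/olt_osup; exists m.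
by apply: IH; move/ole_osup: Hm.
Qed.

Lemma ole_total a b : ole a b \/ olt b a.
Proof.
elim: a b => [|s IH] b; first by left.
have [[n Hn]|H] := pselect (exists n, ole b (s n)).
  by right; apply/olt_osup; exists n.
left; apply/ole_osup => n; case: b H => [|t] H.
  by case: H; exists n.
have [/ole_osup Ht|//] : ole (osup t) (s n) \/ olt (s n) (osup t).
  have [[m Hm]|Ht] := pselect (exists m, ole (s n) (t m)).
    by right; apply/olt_osup; exists m.
  left; apply/ole_osup => m.
  by have [snt|//] := IH n (t m); case: Ht; exists m.
by case: H; exists n; apply/ole_osup.
Qed.

Lemma olt_wf : well_founded olt.
Proof.
suff H : forall a b, ole b a -> Acc olt b.
  by move=> a; exact: (H a a (ole_refl a)).
elim=> [|t IH] b ba; constructor => c cb.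
  by have := olt_ole_trans cb ba => /(_ 0%N).
by have /olt_osup[m cm] := olt_ole_trans cb ba; exact: (IH m).
Qed.

(* Every well-founded relation on a countable type, in particular every
   countable well-order, has its rank function valued in [cord]. *)
Lemma cord_rank (T : countType) (R : T -> T -> Prop) : well_founded R ->
  exists h : T -> cord, forall x c,
    olt c (h x) <-> exists2 y, R y x & ole c (h y).
Proof.
move=> wfR.
pose F x (h : forall y, R y x -> cord) : cord :=
  match pselect (exists y, R y x) with
  | left e => osup (fun n =>
      let d := h (projT1 (cid e)) (projT2 (cid e)) in
      if unpickle n is Some y then
        match pselect (R y x) with left r => h y r | right _ => d end
      else d)
  | right _ => ozero
  end.
have FE x (h h' : forall y, R y x -> cord) :
    (forall y r, h y r = h' y r) -> F x h = F x h'.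
  by move=> hh'; congr F; apply: functional_extensionality_dep => y;
     apply: functional_extensionality_dep => r.
exists (Fix wfR (fun=> cord) F) => x c; rewrite (Fix_eq wfR _ _ FE) {1}/F.
case: pselect => [e|ne]; last first.
  by split=> [/(_ 0%N)//|[y yx _]]; case: ne; exists y.
rewrite olt_osup; split=> [[n]|[y yx cy]].
  have y0x : R (projT1 (cid e)) x by case: (cid e).
  case: (unpickle n) => [y|]; last by exists (projT1 (cid e)).
  by case: pselect => [yx|_] cy; [exists y|exists (projT1 (cid e))].
by exists (pickle y); rewrite pickleK; case: pselect.
Qed.

(* The clauses are mutually exclusive; [oeq] in the first three only accounts
   for the non-uniqueness of codes. *)
Inductive Sigma0 (X : topologicalType) (c : cord) : set X -> Prop :=
| Sigma0_zero : oeq c ozero -> Sigma0 c set0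
| Sigma0_one U : oeq c oone -> open U -> Sigma0 c U
| Sigma0_two (U V : nat -> set X) : oeq c otwo ->
    (forall n, open (U n)) -> (forall n, open (V n)) ->
    Sigma0 c (\bigcup_n (U n `\` V n))
| Sigma0_gt2 (C : nat -> set X) : olt otwo c ->
    (forall n, exists2 d, olt d c & Sigma0 d (~` C n)) ->
    Sigma0 c (\bigcup_n C n).

Definition Pi0 (X : topologicalType) (c : cord) (S : set X) : Prop :=
  Sigma0 c (~` S).

Lemma Sigma0_oeq (X : topologicalType) (c d : cord) (S : set X) :
  oeq c d -> Sigma0 c S -> Sigma0 d S.
Proof.
move=> [cd dc]; have eqd e : oeq c e -> oeq d e.
  by move=> [ce ec]; split; [exact: ole_trans dc ce|exact: ole_trans ec cd].
case=> [/eqd c0|U /eqd c1 oU|U V /eqd c2 oU oV|C c2 HC].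
- exact: Sigma0_zero.
- exact: Sigma0_one.
- exact: Sigma0_two.
- apply: Sigma0_gt2 => [|n]; first exact: olt_ole_trans c2 cd.
  by have [e ec He] := HC n; exists e => //; exact: olt_ole_trans ec cd.
Qed.

Definition Sigma0_measurable (X Z : topologicalType) (c : cord) (f : X -> Z) :
  Prop := forall U : set Z, open U -> Sigma0 c (f @^-1` U).

Definition Pomega : Type := set nat.

HB.instance Definition _ := Pointed.on Pomega.

Definition scott_basic (F : set nat) : set Pomega := [set A | F `<=` A].

Lemma scott_basic_cover : \bigcup_(F in @finite_set nat) scott_basic F = setT.
Proof.
by apply/seteqP; split=> // A _; exists set0; [exact: finite_set0|exact: sub0set].
Qed.

Lemma scott_basic_join (F G : set nat) (A : Pomega) :
  finite_set F -> finite_set G -> scott_basic F A -> scott_basic G A ->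
  exists H, [/\ finite_set H, scott_basic H A &
    scott_basic H `<=` scott_basic F `&` scott_basic G].
Proof.
move=> finF finG FA GA; exists (F `|` G); split.
- by rewrite finite_setU.
- by rewrite /scott_basic /= subUset.
- by move=> B; rewrite /scott_basic /= subUset.
Qed.

HB.instance Definition _ :=
  isBaseTopological.Build Pomega scott_basic_cover scott_basic_join.

(* Main.v *)
(* Since Sigma^0 sets of a subspace are traces of Sigma^0 sets of the same class,
   the preimages f^-1 {y | n in y} extend to P(omega) and define a total
   F : P(omega) -> P(omega) extending f, measurable for the same class; likewise
   G extends g. Then F and G restrict to mutually inverse bijections between
   A* = {x | G (F x) = x} and B* = {y | F (G y) = y}. As G o F is
   Sigma_(1+alpha+beta)-measurable, its fixed points form a
   Pi_(1+alpha+beta+1) set. *)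
Require Import Defs.
From mathcomp Require Import all_boot all_order.
From mathcomp Require Import all_classical.
From mathcomp Require Import topology.

Set Implicit Arguments.
Unset Strict Implicit.
Unset Printing Implicit Defensive.

Local Open Scope classical_set_scope.

(** * Order, maximum and addition of codes *)

Lemma olt_irr a : ~ olt a a.
Proof.
elim: a => [/(_ 0%N)//|s IH] /olt_osup[m H]; apply: (IH m).
by move/ole_osup: H.
Qed.

Lemma ole_omaxl a b : ole a (omax a b).
Proof. by rewrite /omax; case: asboolP => // _; exact: ole_refl. Qed.

Lemma ole_omaxr a b : ole b (omax a b).
Proof.
rewrite /omax; case: asboolP => [_|nab]; first exact: ole_refl.
by have [/nab//|/oltW] := ole_total a b.
Qed.

Lemma omax_lt a b c : olt a c -> olt b c -> olt (omax a b) c.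
Proof. by rewrite /omax; case: asboolP. Qed.

Lemma oltS a : olt a (osucc a).
Proof. exact: ole_refl. Qed.

Lemma ole_oaddr a b : ole a (oadd a b).
Proof.
elim: b => [|t IH] /=; first exact: ole_refl.
by apply/oltW/olt_osup; exists 0%N.
Qed.

Lemma ole_oadd2l c a b : ole a b -> ole (oadd c a) (oadd c b).
Proof.
elim: a b => [|s IH] [|t] ab; [exact: ole_refl|exact: ole_oaddr|by have := ab 0%N|].
apply/ole_osup => n; apply/olt_osup.
by have [m /IH snt] := ab n; exists m.
Qed.

Lemma ole_osucc2 a b : ole a b -> ole (osucc a) (osucc b).
Proof. by move=> ab; apply/ole_osup => _; apply/olt_osup; exists 0%N. Qed.

(** * Closure properties of the Borel classes of an arbitrary space *)

Lemma bigcup_natE (X : Type) (S : set X) : \bigcup_(n : nat) S = S.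
Proof. by apply/seteqP; split=> [x [] //|x Sx]; exists 0%N. Qed.

Section Borel.
Context {X : topologicalType}.
Implicit Types (c d : cord) (S U V : set X).

Lemma Sigma0_open c U : ole oone c -> open U -> Sigma0 c U.
Proof.
move=> c1 oU; have [c1'|c2] := ole_total c oone; first exact: Sigma0_one.
have TU V W : open V -> open W -> Sigma0 otwo (V `\` W).
  move=> oV oW; rewrite -(bigcup_natE (V `\` W)).
  by apply: (@Sigma0_two _ _ (fun=> V) (fun=> W)) => //; split; exact: ole_refl.
have [c2'|c2'] := ole_total c otwo.
  by apply: (@Sigma0_oeq _ otwo) => //; rewrite -(setD0 U); apply: TU => //; exact: open0.
(* Above level two, [U] is a one-term union whose complement [setT \ U] is a difference of open
   sets. *)
rewrite -(bigcup_natE U).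
apply: Sigma0_gt2 => // _; exists otwo => //; rewrite -setTD.
by apply: TU => //; exact: openT.
Qed.

Lemma Sigma0_set0 c : Sigma0 c (@set0 X).
Proof.
have [c0|] := ole_total c ozero; first exact: Sigma0_zero.
by move=> /Sigma0_open; apply; exact: open0.
Qed.

Lemma Sigma0_lt1 c S : ole c ozero -> Sigma0 c S -> S = set0.
Proof.
move=> c0 [//|U [_ c1]|U V [_ c2]|C c2].
- by have := ole_trans c1 c0 => /(_ 0%N).
- by have := ole_trans c2 c0 => /(_ 0%N).
- by have := ole_trans c2 c0 => /(_ 0%N).
Qed.

Lemma olt12 : olt oone otwo. Proof. exact: oltS. Qed.

Lemma Sigma0_oone c S : oeq c oone -> Sigma0 c S -> open S.
Proof.
move=> [c1 _] [_|U _ //|U V [_ c2]|C c2]; first exact: open0.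
- by case: (@olt_irr oone); apply: olt_ole_trans olt12 (ole_trans c2 c1).
- case: (@olt_irr oone); apply: olt_ole_trans olt12 _.
  exact: ole_trans (oltW c2) c1.
Qed.

Lemma Sigma0_otwo c S : oeq c otwo -> Sigma0 c S ->
  exists U V : nat -> set X, [/\ forall n, open (U n), forall n, open (V n)
    & S = \bigcup_n (U n `\` V n)].
Proof.
move=> [c2 c2'] [[c0 _]|U [c1 _]|U V _ oU oV|C c3].
- by have := ole_trans c2' c0 => /(_ 0%N).
- by case: (@olt_irr oone); apply: olt_ole_trans olt12 (ole_trans c2' c1).
- by exists U, V.
- by case: (@olt_irr otwo); apply: olt_ole_trans c3 c2.
Qed.

Lemma Sigma0_gt2_inv c S : olt otwo c -> Sigma0 c S ->
  exists C : nat -> set X, (forall n, exists2 d, olt d c & Sigma0 d (~` C n))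
    /\ S = \bigcup_n C n.
Proof.
move=> c3 [[c0 _]|U [c1 _]|U V [c2 _]|C _ HC].
- by have := ole_trans c3 c0 => /(_ 0%N).
- case: (@olt_irr otwo); apply: olt_ole_trans c3 _.
  exact: ole_trans c1 (oltW olt12).
- by case: (@olt_irr otwo); apply: olt_ole_trans c3 c2.
- by exists C.
Qed.

Lemma cord_case c : [\/ ole c ozero, oeq c oone, oeq c otwo | olt otwo c].
Proof.
have [|c0] := ole_total c ozero; first by constructor 1.
have [|c1] := ole_total c oone; first by constructor 2.
by have [|c2] := ole_total c otwo; [constructor 3|constructor 4].
Qed.

Lemma bigcup_nat2 (C : nat -> nat -> set X) : exists g : nat -> nat * nat,
  \bigcup_n \bigcup_m C n m = \bigcup_k C (g k).1 (g k).2.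
Proof.
(* The default pair is harmless: [C 0 0] belongs to the double union anyway. *)
exists (fun k => odflt (0%N, 0%N) (unpickle k)); apply/seteqP; split=> x.
  by move=> [n _ [m _ Cx]]; exists (pickle (n, m)) => //; rewrite pickleK.
by move=> [k _ Cx]; do 2 (eexists; first by []); exact: Cx.
Qed.

(** From level two on, each [S n] is itself a countable union of sets of one shape, so the double
    union is re-indexed by a single natural number. *)
Lemma Sigma0_bigcup c (S : nat -> set X) :
  (forall n, Sigma0 c (S n)) -> Sigma0 c (\bigcup_n S n).
Proof.
move=> HS; have [c0|c1|c2|c2] := cord_case c.
- rewrite bigcup0; first exact: Sigma0_set0.
  by move=> n _; apply: Sigma0_lt1 c0 (HS n).
- by apply: Sigma0_one => //; apply: bigcup_open => n _; apply: Sigma0_oone (HS n).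
- have /choice[U /choice[V UV]] := fun n => Sigma0_otwo c2 (HS n).
  have -> : \bigcup_n S n = \bigcup_n \bigcup_m (U n m `\` V n m).
    by apply: eq_bigcupr => n _; have [] := UV n.
  have [g ->] := bigcup_nat2 (fun n m => U n m `\` V n m).
  apply: (@Sigma0_two _ _ (fun k => U (g k).1 (g k).2) (fun k => V (g k).1 (g k).2)) => // k;
    by have [] := UV (g k).1.
- have /choice[C HC] := fun n => Sigma0_gt2_inv c2 (HS n).
  have -> : \bigcup_n S n = \bigcup_n \bigcup_m C n m.
    by apply: eq_bigcupr => n _; have [] := HC n.
  have [g ->] := bigcup_nat2 C.
  by apply: Sigma0_gt2 => // k; have [] := HC (g k).1.
Qed.

Lemma Sigma0_setU c S T : Sigma0 c S -> Sigma0 c T -> Sigma0 c (S `|` T).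
Proof.
move=> HS HT; rewrite -bigcup2E; apply: Sigma0_bigcup => -[|[|n]] //=.
exact: Sigma0_set0.
Qed.

Lemma Sigma0_openD c U V : ole otwo c -> open U -> open V -> Sigma0 c (U `\` V).
Proof.
move=> c2 oU oV; rewrite -(bigcup_natE (U `\` V)).
have [c2'|c3] := ole_total c otwo.
  exact: (@Sigma0_two _ _ (fun=> U) (fun=> V)).
(* The complement of [U \ V] is the union of [V] and the complement of [U], both of class two. *)
apply: Sigma0_gt2 => // _; exists otwo => //; rewrite setCD setUC.
apply: Sigma0_setU; first by apply: Sigma0_open => //; exact: oltW olt12.
rewrite -setTD -(bigcup_natE (_ `\` U)).
apply: (@Sigma0_two _ _ (fun=> setT) (fun=> U)).
- by split; exact: ole_refl.
- by move=> _; exact: openT.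
- by [].
Qed.

(** The first three clauses fix the level, so open sets and differences of open sets have to be
    placed in every higher class separately; the strict bounds of the last clause simply carry
    over. *)
Lemma Sigma0_le c d S : ole c d -> Sigma0 c S -> Sigma0 d S.
Proof.
move=> cd; case=> [_|U [_ c1]|U V [_ c2] oU oV|C c2 HC].
- exact: Sigma0_set0.
- by apply: Sigma0_open; exact: ole_trans cd.
- apply: Sigma0_bigcup => n; apply: Sigma0_openD => //; exact: ole_trans cd.
- apply: Sigma0_gt2 => [|n]; first exact: olt_ole_trans cd.
  by have [e ec He] := HC n; exists e => //; exact: olt_ole_trans ec cd.
Qed.

(** From level two on, the complement is a one-term union in the last clause. Below that, [S] is
    empty or open, and its complement is the whole space or a difference of open sets. *)
Lemma Sigma0_setC c d S : olt c d -> Sigma0 c S -> Sigma0 d (~` S).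
Proof.
move=> cd HS; have [c2|c2] := ole_total otwo c.
  rewrite -(bigcup_natE (~` S)).
  apply: Sigma0_gt2 => [|_]; first exact: ole_olt_trans cd.
  by exists c => //; rewrite setCK.
have [c0|c1] := ole_total c ozero.
  rewrite (Sigma0_lt1 c0 HS) setC0; apply: Sigma0_open; last exact: openT.
  by apply: ole_trans cd; apply: ole_osucc2.
have c1' : ole c oone by move: c2 => /olt_osup[_].
have oS : open S by apply: Sigma0_oone HS.
rewrite -setTD; apply: Sigma0_openD => //; last exact: openT.
by apply: ole_trans cd; apply: ole_osucc2.
Qed.

Lemma Sigma0_setI c S T : Sigma0 c S -> Sigma0 c T -> Sigma0 c (S `&` T).
Proof.
move=> HS HT; have [c0|c1|c2|c2] := cord_case c.
- by rewrite (Sigma0_lt1 c0 HS) set0I; exact: Sigma0_set0.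
- by apply: Sigma0_one => //; apply: openI; [apply: Sigma0_oone HS|apply: Sigma0_oone HT].
- have [U [V [oU oV ->]]] := Sigma0_otwo c2 HS.
  have [U' [V' [oU' oV' ->]]] := Sigma0_otwo c2 HT.
  rewrite setI_bigcupl; apply: Sigma0_bigcup => n.
  rewrite setI_bigcupr; apply: Sigma0_bigcup => m.
  rewrite setDE setDE setIACA -setCU -setDE.
  by apply: Sigma0_openD; [case: c2|exact: openI|exact: openU].
- have [C [HC ->]] := Sigma0_gt2_inv c2 HS.
  have [D [HD ->]] := Sigma0_gt2_inv c2 HT.
  rewrite setI_bigcupl; apply: Sigma0_bigcup => n.
  rewrite setI_bigcupr; apply: Sigma0_bigcup => m.
  have [d dc Hd] := HC n; have [e ec He] := HD m.
  (* The complement of [C n] meet [D m] is a union of sets of classes [d] and [e], hence of class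
     [omax d e], which is still below [c]. *)
  rewrite -(setCK (_ `&` _)); apply: (@Sigma0_setC (omax d e)); first exact: omax_lt.
  rewrite setCI; apply: Sigma0_setU.
    exact: Sigma0_le (ole_omaxl _ _) Hd.
  exact: Sigma0_le (ole_omaxr _ _) He.
Qed.

Lemma Sigma0_setD c d S T : olt c d -> Sigma0 c S -> Sigma0 c T ->
  Sigma0 d (S `\` T).
Proof.
move=> cd HS HT; rewrite setDE; apply: Sigma0_setI.
  exact: Sigma0_le (oltW cd) HS.
exact: Sigma0_setC HT.
Qed.

End Borel.

(** * Preimages and traces on subspaces *)

Lemma Sigma0_preimage_continuous (X Y : topologicalType) (h : X -> Y) c S :
  (forall U, open U -> open (h @^-1` U)) -> Sigma0 c S -> Sigma0 c (h @^-1` S).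
Proof.
(* Induction along [olt]: a class [d] below [c] in the last clause need not be a subcode of [c]. *)
move=> ch; move: c S; apply: (well_founded_ind olt_wf) => c IH S.
case=> [c0|U c1 oU|U V c2 oU oV|C c2 HC].
- exact: Sigma0_set0.
- by apply: Sigma0_one => //; exact: ch.
- apply: (@Sigma0_two _ _ (fun n => h @^-1` U n) (fun n => h @^-1` V n)) => // n;
  exact: ch.
- apply: (@Sigma0_gt2 _ _ (fun n => h @^-1` C n)) => // n.
  by have [d dc Hd] := HC n; exists d => //; exact: IH Hd.
Qed.

Lemma open_set_val (X : topologicalType) (A : set X) (U : set X) :
  open U -> open (set_val @^-1` U : set A).
Proof. by move=> oU; exists U. Qed.

(** Preimage under [set_val] commutes with unions, differences and complements, so extensions can be
    chosen for the constituents of each clause; in the last one, [~] [C n] is extended and the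
    extension complemented. *)
Lemma Sigma0_subspace (X : topologicalType) (A : set X) c (S : set A) :
  Sigma0 c S -> exists2 S' : set X, Sigma0 c S' & S = set_val @^-1` S'.
Proof.
move: c S; apply: (well_founded_ind olt_wf) => c IH S.
case=> [c0|U c1 [U' oU' <-]|U V c2 oU oV|C c2 HC].
- by exists set0; first exact: Sigma0_set0.
- by exists U' => //; exact: Sigma0_one.
- have /choice[U' HU] n : exists U', open U' /\ U n = set_val @^-1` U'.
    by have [U' oU' <-] := oU n; exists U'.
  have /choice[V' HV] n : exists V', open V' /\ V n = set_val @^-1` V'.
    by have [V' oV' <-] := oV n; exists V'.
  exists (\bigcup_n (U' n `\` V' n)).
    by apply: Sigma0_two => // n; [have [] := HU n|have [] := HV n].
  rewrite preimage_bigcup; apply: eq_bigcupr => n _.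
  by have [_ ->] := HU n; have [_ ->] := HV n.
- have /choice[C' HC'] n : exists C', (exists2 d, olt d c & Sigma0 d (~` C'))
      /\ C n = set_val @^-1` C'.
    have [d dc /(IH _ dc)[D HD CD]] := HC n; exists (~` D); split.
      by exists d => //; rewrite setCK.
    by rewrite -[C n]setCK CD.
  exists (\bigcup_n C' n); first by apply: Sigma0_gt2 => // n; have [] := HC' n.
  by rewrite preimage_bigcup; apply: eq_bigcupr => n _; have [_ ->] := HC' n.
Qed.

(** Structural induction on [b] suffices: a class below [1 + osup t] is at most some [1 + t m],
    whose preimages have class [c + t m], and complementing them stays within [c + osup t]. *)
Lemma Sigma0_preimage (X Y : topologicalType) (h : X -> Y) c b S :
  ole oone c -> Sigma0_measurable c h -> Sigma0 (oadd oone b) S ->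
  Sigma0 (oadd c b) (h @^-1` S).
Proof.
move=> c1 hm; elim: b S => [|t IH] S HS.
  apply: hm; apply: Sigma0_oone HS; split; exact: ole_refl.
have ct m : olt (oadd c (t m)) (oadd c (osup t)) by apply/olt_osup; exists m; exact: ole_refl.
case: HS => [_|U _ oU|U V _ oU oV|C _ HC].
- exact: Sigma0_set0.
- by apply: Sigma0_le (hm _ oU); exact: ole_oaddr.
(* Preimages of open sets have class [c] only, so their difference costs one level, available since
   [c <= c + t 0 < c + osup t]. *)
- rewrite preimage_bigcup; apply: Sigma0_bigcup => n.
  by apply: (@Sigma0_setD _ _ _ (h @^-1` U n) (h @^-1` V n)
    (ole_olt_trans (ole_oaddr c _) (ct 0%N))); exact: hm.
- rewrite preimage_bigcup; apply: Sigma0_bigcup => n.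
  have [d /olt_osup[m dm] Hd] := HC n.
  rewrite -(setCK (_ @^-1` _)); apply: (Sigma0_setC (ct m)).
  exact: (IH m _ (Sigma0_le dm Hd)).
Qed.

(** * Measurable maps into P(omega) *)

Lemma open_Pomega_mem n : open [set y : Pomega | y n].
Proof.
exists [set [set n]]; first by move=> _ ->; exact: finite_set1.
apply/seteqP; split=> y /=; first by move=> [_ -> /(_ n)]; apply.
by move=> yn; exists [set n] => // _ ->.
Qed.

(** There are only countably many finite sets, so every open set is a countable union of finite
    intersections of the subbasic sets [[set y | y n]]. *)
Lemma Pomega_measurable (X : topologicalType) c (h : X -> Pomega) :
  ole oone c -> (forall n, Sigma0 c [set x | h x n]) -> Sigma0_measurable c h.
Proof.
move=> c1 hn U [D Dfin <-].
have HF (s : seq nat) : Sigma0 c [set x | forall n, n \in s -> h x n].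
  elim: s => [|n s IH].
    by rewrite (_ : [set _ | _] = setT); [apply: Sigma0_open => //; exact: openT|apply/seteqP; split].
  rewrite (_ : [set _ | _] = [set x | h x n] `&` [set x | forall n, n \in s -> h x n]).
    exact: Sigma0_setI.
  apply/seteqP; split=> x /=.
    by move=> H; split=> [|m ms]; apply: H; rewrite inE ?eqxx// ms orbT.
  by move=> [hxn H] m; rewrite inE => /orP[/eqP->|/H].
(* [E] discards the sequences not listing a member of [D], so the union can run over all codes; a
   number without a decoding is read as the empty sequence, tested like any other. *)
pose E (s : seq nat) : set X :=
  if `[< D [set` s] >] then [set x | forall n, n \in s -> h x n] else set0.
have -> : h @^-1` (\bigcup_(F in D) scott_basic F) =
    \bigcup_k E (odflt [::] (unpickle k)).
  apply/seteqP; split=> x.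
    move=> [F DF Fx]; have /finite_seqP[s Fs] := Dfin _ DF.
    exists (pickle s) => //; rewrite pickleK /E /= asboolT -?Fs// => n ns.
    by apply: Fx; rewrite Fs.
  by move=> [k _]; rewrite /E; case: asboolP => // Ds H; eexists; first exact: Ds.
by apply: Sigma0_bigcup => k; rewrite /E; case: ifP => _;
  [exact: HF|exact: Sigma0_set0].
Qed.

Lemma Pomega_extension (A : set Pomega) c (f : A -> Pomega) :
  ole oone c -> Sigma0_measurable c f ->
  exists2 F : Pomega -> Pomega, Sigma0_measurable c F
    & forall x : A, F (set_val x) = f x.
Proof.
move=> c1 fm.
have /choice[S HS] n : exists S', Sigma0 c S' /\ [set x | f x n] = set_val @^-1` S'.
  by have [S' ? ?] := Sigma0_subspace (fm _ (open_Pomega_mem n)); exists S'.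
(* Any family of sets [S n] defines a total map, because every subset of omega is a point of
   P(omega). *)
exists (fun x => [set n | S n x]).
  apply: Pomega_measurable => // n.
  by have [] := HS n.
move=> x; apply/funext => n; have [_ /(congr1 (fun T : set A => T x)) E] := HS n.
exact: esym E.
Qed.

(** The points [h x] and [x] differ exactly when some [n] lies in one and not in the other; this is
    a countable union of differences of sets of class [c]. *)
Lemma Pi0_fixpoints c (h : Pomega -> Pomega) :
  ole oone c -> Sigma0_measurable c h -> Pi0 (osucc c) [set x | h x = x].
Proof.
move=> c1 hm; rewrite /Pi0.
have -> : ~` [set x | h x = x] =
    \bigcup_n (([set x | h x n] `\` [set x | x n]) `|`
               ([set x | x n] `\` [set x | h x n])).
  apply/seteqP; split=> x /=.
    move=> hx; apply: contrapT => H; apply: hx; apply/seteqP.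
    split=> n xn; apply: contrapT => H'; apply: H; exists n => //.
      by left.
    by right.
  by move=> [n _ [[/= H H']|[/= H H']] E]; apply: H' => /=;
    [rewrite -E|rewrite E]; exact: H.
apply: Sigma0_bigcup => n.
have Hh : Sigma0 c [set x | h x n] by exact: hm (open_Pomega_mem n).
have Hx : Sigma0 c [set x : Pomega | x n].
  by apply: Sigma0_open => //; exact: open_Pomega_mem.
by apply: Sigma0_setU; apply: Sigma0_setD (oltS c) _ _.
Qed.

(** An open set of [B] is the trace of an open [V], and its preimage under [f] is the trace of the
    preimage of [V] under [F]. *)
Lemma Sigma0_measurable_sub (X Y : topologicalType) (A : set X) (B : set Y) c
    (F : X -> Y) (f : A -> B) :
  (forall x, set_val (f x) = F (set_val x)) -> Sigma0_measurable c F ->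
  Sigma0_measurable c f.
Proof.
move=> fF Fm _ [V oV <-].
rewrite (_ : _ @^-1` _ = set_val @^-1` (F @^-1` V)).
  apply: Sigma0_preimage_continuous (Fm _ oV).
  exact: open_set_val.
by apply/seteqP; split=> x; rewrite /preimage /= fF.
Qed.

(** * Extension to the fixed-point sets of the two composites *)

Theorem theorem3p2 (A B : set Pomega) (alpha beta : cord)
    (f : A -> B) (g : B -> A) :
  cancel f g -> cancel g f ->
  Sigma0_measurable (oadd oone alpha) f ->
  Sigma0_measurable (oadd oone beta) g ->
  let mu := omax alpha beta in
  exists (As Bs : set Pomega) (fs : As -> Bs) (gs : Bs -> As),
    [/\ Pi0 (oadd (oadd (oadd oone alpha) mu) oone) As
      & Pi0 (oadd (oadd (oadd oone beta) mu) oone) Bs] /\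
    [/\ cancel fs gs, cancel gs fs,
        Sigma0_measurable (oadd oone alpha) fs
      & Sigma0_measurable (oadd oone beta) gs] /\
    [/\ A `<=` As, B `<=` Bs,
        forall (x : A) (y : As), set_val y = set_val x -> set_val (fs y) = set_val (f x)
      & forall (x : B) (y : Bs), set_val y = set_val x -> set_val (gs y) = set_val (g x)].
Proof.
move=> fK gK fm gm mu.
have one_le := ole_oaddr oone.
have [F Fm Ff] : exists2 F : Pomega -> Pomega,
    Sigma0_measurable (oadd oone alpha) F & forall x : A, F (set_val x) = set_val (f x).
  by apply: Pomega_extension => // U oU; apply: (fm (set_val @^-1` U)); exact: open_set_val.
have [G Gm Gg] : exists2 G : Pomega -> Pomega,
    Sigma0_measurable (oadd oone beta) G & forall x : B, G (set_val x) = set_val (g x).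
  by apply: Pomega_extension => // U oU; apply: (gm (set_val @^-1` U)); exact: open_set_val.
pose As := [set x | G (F x) = x]; pose Bs := [set y | F (G y) = y].
(* Applying [F] to [G (F x) = x] shows that [F x] is fixed by the other composite. *)
have FAs (x : As) : F (set_val x) \in Bs.
  by apply/mem_set; rewrite /Bs /= (set_mem (valP x)).
have GBs (y : Bs) : G (set_val y) \in As.
  by apply/mem_set; rewrite /As /= (set_mem (valP y)).
pose fs (x : As) : Bs := SigSub (FAs x).
pose gs (y : Bs) : As := SigSub (GBs y).
exists As, Bs, fs, gs; split; [split|split; split].
(* Adding [oone] computes to [osucc], and [beta <= mu] is used in the right summand, where addition
   is monotone. *)
- apply: (@Sigma0_le _ (osucc (oadd (oadd oone alpha) beta))).
    by apply/ole_osucc2/ole_oadd2l/ole_omaxr.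
  apply: (@Pi0_fixpoints _ (G \o F)) => [|U oU].
    by apply: ole_trans (one_le alpha) (ole_oaddr _ _).
  (* [G] pulls [U] back to class [1 + beta]; pulling back further along [F] replaces the leading 1
     by [1 + alpha]. *)
  exact: (Sigma0_preimage (one_le _) Fm (Gm U oU)).
- apply: (@Sigma0_le _ (osucc (oadd (oadd oone beta) alpha))).
    by apply/ole_osucc2/ole_oadd2l/ole_omaxl.
  apply: (@Pi0_fixpoints _ (F \o G)) => [|U oU].
    by apply: ole_trans (one_le beta) (ole_oaddr _ _).
  exact: (Sigma0_preimage (one_le _) Gm (Fm U oU)).
- by move=> x; apply: val_inj; exact: (set_mem (valP x)).
- by move=> y; apply: val_inj; exact: (set_mem (valP y)).
- exact: (@Sigma0_measurable_sub _ _ _ _ _ F).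
- exact: (@Sigma0_measurable_sub _ _ _ _ _ G).
(* On [A] the composite is [g] after [f], so its points are fixed. *)
- move=> x /mem_set xA; rewrite /As /=.
  by have := Gg (f (exist _ x xA)); rewrite -Ff fK.
- move=> y /mem_set yB; rewrite /Bs /=.
  by have := Ff (g (exist _ y yB)); rewrite -Gg gK.
- by move=> x y yx; rewrite -Ff -yx.
- by move=> x y yx; rewrite -Gg -yx.
Qed.
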